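(* Let $k$ be even and let $\lambda,\mu\in U_{2k}$ be primitive roots. If we set $Z=\lambda A_\mu$, then $$\mathrm{Aut}_{\mathfrak{s}_k}=\{\xi A_\eta Z^\delta:\ (\xi,\eta,\delta)\in U_k\times U_k\times\{0,1\}\},$$ which is isomorphic to $\mathbb{Z}_k\times\mathbb{Z}_k$.
   Context: For a positive integer $k$, the polynomials $p_0^k$ and $p_1^{k-1}$ in two variables are determined by $(x+\imath y)^k=p_0^k(x,y^2)+\imath\, y\,p_1^{k-1}(x,y^2)$ for $x,y\in\mathbb{R}$. Let $\mathcal{S}=\{(s_1,s_2,s_3)\in\mathbb{C}^3: s_1^2+s_2^2+s_3^2=1\}$, $$W=\{((u_0,u_1),s)\in\mathbb{C}^2\times\mathcal{S}:\ u_0\neq0,\ u_1\neq0,\ u_0^2+u_1^2\neq0\},$$ $$W_k=\{((u_0,u_1),s)\in W:\ p_1^{k-1}(u_0,u_1^2)\neq0\},$$ and let $\mathfrak{s}_k$ be given by $$\mathfrak{s}_k((u_0,u_1),s)=\big((p_0^k(u_0,u_1^2),\ u_1p_1^{k-1}(u_0,u_1^2)),\ s\big),$$ considered as a covering map $\mathfrak{s}_k:W_k\to W$ of degree $k^2$. For a covering map $\pi:X\to Y$, $\mathrm{Aut}_\pi$ denotes the group of automorphisms $f$ of $X$ such that $\pi\circ f=\pi$. $U_n$ is the group of complex $n$-th roots of unity (so $\lambda,\mu$ are primitive $2k$-th roots of $1$), and for $\eta\in\mathbb{C}$ $$A_\eta=\begin{pmatrix}\mathrm{Re}\,\eta&-\mathrm{Im}\,\eta\\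 \mathrm{Im}\,\eta&\mathrm{Re}\,\eta\end{pmatrix}.$$ A complex $2\times2$ matrix $M$ is identified with the map $(u,s)\mapsto(Mu,s)$, $u\in\mathbb{C}^2$, $s\in\mathcal{S}$. *)

(* Defs.v *)
From HB Require Import structures.
From mathcomp Require Import all_boot all_order all_algebra.
From mathcomp Require Import all_classical all_reals all_analysis.
From mathcomp Require Import complex polyXY ring.

Set Implicit Arguments.
Unset Strict Implicit.
Unset Printing Implicit Defensive.

Import Order.TTheory GRing.Theory Num.Theory numFieldNormedType.Exports.
Local Open Scope classical_set_scope.
Local Open Scope complex_scope.
Local Open Scope ring_scope.

(* [p.[a, b]] substitutes [a] for the outer and [b] for the inner variable.
   Complex coefficients are allowed so that [p] can be evaluated on C^2; the
   identity on real points still determines the pair ([pk_pairU] below), whose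
   coefficients are in fact integers. *)
Definition pk_pair (R : realType) (k : nat) (p0 p1 : {poly {poly R[i]}}) :=
  forall x y : R,
    (x%:C + 'i * y%:C) ^+ k =
      p0.[x%:C, y%:C ^+ 2] + 'i * y%:C * p1.[x%:C, y%:C ^+ 2].

Lemma pk_ex (C : numClosedFieldType) (k : nat) :
  exists p0 p1 : {poly {poly C}}, forall x y : C,
    (x + 'i * y) ^+ k = p0.[x, y ^+ 2] + 'i * y * p1.[x, y ^+ 2].
Proof.
elim: k => [|k [p0 [p1 IH]]].
  by exists 1, 0 => x y; rewrite expr0 !(hornerC, horner0) mulr0 addr0.
exists ('X * p0 - 'X%:P * p1), (p0 + 'X * p1) => x y.
rewrite exprS IH !(hornerD, hornerN, hornerM, hornerX, hornerC).
set a := p0.[_, _]; set b := p1.[_, _].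
transitivity (x * a + 'i ^+ 2 * y ^+ 2 * b + 'i * y * (a + x * b)); first by ring.
by rewrite sqrCi mulN1r mulNr.
Qed.

Lemma pk_pair_ex (R : realType) (k : nat) :
  exists p0 p1 : {poly {poly R[i]}}, pk_pair k p0 p1.
Proof.
by have [p0 [p1 hp]] := @pk_ex R[i] k; exists p0, p1 => x y; exact: hp.
Qed.

Lemma poly_inf_roots_eq0 (D : idomainType) (p : {poly D}) (f : nat -> D) :
  injective f -> (forall n, root p (f n)) -> p = 0.
Proof.
move=> finj rootf; apply/eqP/negPn/negP => pn0.
have := max_poly_roots pn0 (rs := [seq f n | n <- iota 0 (size p)]).
rewrite size_map size_iota ltnn map_inj_uniq // iota_uniq.
by move=> /(_ _ erefl) H; have : false by apply: H; apply/allP => _ /mapP[n _ ->].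
Qed.

Lemma pk_uniq (C : numClosedFieldType) (p0 p1 q0 q1 : {poly {poly C}}) :
  (forall x y : C, x \is Num.real -> y \is Num.real ->
    p0.[x, y ^+ 2] + 'i * y * p1.[x, y ^+ 2] =
    q0.[x, y ^+ 2] + 'i * y * q1.[x, y ^+ 2]) ->
  p0 = q0 /\ p1 = q1.
Proof.
move=> h.
have key (m n : nat) :
    p0.[m%:R, n.+1%:R ^+ 2] = q0.[m%:R, n.+1%:R ^+ 2] /\
    p1.[m%:R, n.+1%:R ^+ 2] = q1.[m%:R, n.+1%:R ^+ 2].
  have := h m%:R (- n.+1%:R) (realn _ _) _; rewrite realN => /(_ (realn _ _)).
  have := h m%:R n.+1%:R (realn _ _) (realn _ _); rewrite sqrrN.
  set a := p0.[_, _]; set b := p1.[_, _].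
  set c := q0.[_, _]; set d := q1.[_, _] => e1 e2.
  have t0 : 'i * n.+1%:R != 0 :> C by rewrite mulf_neq0 ?neq0Ci ?pnatr_eq0.
  have ac : a = c.
    apply: (@mulfI _ 2%:R); first by rewrite pnatr_eq0.
    have -> : 2%:R * a = (a + 'i * n.+1%:R * b) + (a + 'i * - n.+1%:R * b).
      by ring.
    by rewrite e1 e2; ring.
  by split=> //; move: e1; rewrite ac => /addrI /(mulfI t0).
have zero (q : {poly {poly C}}) :
    (forall m n : nat, q.[m%:R, n.+1%:R ^+ 2] = 0) -> q = 0.
  move=> hz; apply: (@poly_inf_roots_eq0 _ _ (fun n : nat => n%:R%:P)).
    by move=> m n /polyC_inj/eqP; rewrite eqr_nat => /eqP.
  move=> m; apply/eqP.
  apply: (@poly_inf_roots_eq0 _ _ (fun n : nat => n.+1%:R ^+ 2)).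
    by move=> n n' /eqP; rewrite eqrXn2 ?ler0n// eqr_nat => /eqP[].
  by move=> n; apply/eqP/hz.
split; apply/eqP; rewrite -subr_eq0; apply/eqP/zero => m n;
  by have [e0 e1] := key m n; rewrite !hornerD !hornerN ?e0 ?e1 subrr.
Qed.

Lemma pk_pairU (R : realType) (k : nat) (p0 p1 q0 q1 : {poly {poly R[i]}}) :
  pk_pair k p0 p1 -> pk_pair k q0 q1 -> p0 = q0 /\ p1 = q1.
Proof.
move=> hp hq; apply: pk_uniq => x y /complex_realP[a ->] /complex_realP[b ->].
by rewrite -hp hq.
Qed.

(* The ambient space C^2 x C^3; [R[i]^o] carries the usual topology of C. *)
Definition ambient (R : realType) : topologicalType :=
  ('cV[R[i]^o]_2 * 'cV[R[i]^o]_3)%type.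

Definition u0 (R : realType) (x : ambient R) : R[i] := x.1 0 0.
Definition u1 (R : realType) (x : ambient R) : R[i] := x.1 1 0.

Definition sphere (R : realType) : set 'cV[R[i]^o]_3 :=
  [set s | \sum_(j < 3) (s j 0 : R[i]) ^+ 2 = 1].

Definition W (R : realType) : set (ambient R) :=
  [set x | [/\ sphere x.2, u0 x != 0, u1 x != 0
             & u0 x ^+ 2 + u1 x ^+ 2 != 0]].

Definition Wk (R : realType) (p1 : {poly {poly R[i]}}) : set (ambient R) :=
  [set x | W x /\ p1.[u0 x, u1 x ^+ 2] != 0].

Definition sk (R : realType) (p0 p1 : {poly {poly R[i]}}) (x : ambient R) :
    ambient R :=
  (\col_(i < 2) [:: p0.[u0 x, u1 x ^+ 2]; u1 x * p1.[u0 x, u1 x ^+ 2]]`_i,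
   x.2).

Definition homeo (X : topologicalType) (f : X -> X) :=
  continuous f /\ exists g : X -> X, [/\ continuous g, cancel f g & cancel g f].

(* Automorphisms of the covering given by [pi]; only the values of [pi] matter,
   so its codomain need not be cut down to the base of the covering. *)
Definition cov_aut (X : topologicalType) (Y : Type) (pi : X -> Y) :
    set (X -> X) :=
  [set f | homeo f /\ pi \o f = pi].

Lemma cov_aut_id (X : topologicalType) (Y : Type) (pi : X -> Y) :
  cov_aut pi id.
Proof.
have cid : continuous (@id X) by move=> x; exact: cvg_id.
by do 2!split => //; exists id.
Qed.

Lemma cov_aut_comp (X : topologicalType) (Y : Type) (pi : X -> Y)
    (f g : X -> X) :
  cov_aut pi f -> cov_aut pi g -> cov_aut pi (f \o g).
Proof.
move=> [[cf [f' [cf' fK f'K]]] pf] [[cg [g' [cg' gK g'K]]] pg].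
split; last by rewrite compA pf pg.
split; first by move=> x; apply: continuous_comp; [exact: cg|exact: cf].
exists (g' \o f'); split; [|exact: can_comp fK gK|exact: can_comp g'K f'K].
by move=> x; apply: continuous_comp; [exact: cf'|exact: cg'].
Qed.

Lemma cov_aut_inv (X : topologicalType) (Y : Type) (pi : X -> Y) (f : X -> X) :
  cov_aut pi f -> exists2 g, cov_aut pi g & f \o g = id /\ g \o f = id.
Proof.
move=> [[cf [g [cg fK gK]]] pf]; exists g; last by split; apply/funext.
split; first by split=> //; exists f.
by rewrite -[in LHS]pf -compA; apply/funext => x /=; rewrite gK.
Qed.

(* [G] is a group under composition, isomorphic to the additive group [A]. *)
Definition comp_isog (X : Type) (G : set (X -> X)) (A : zmodType) :=
  exists phi : A -> (X -> X),
    [/\ injective phi, range phi = G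
      & forall a b : A, phi (a + b) = phi a \o phi b].

Definition U (R : realType) (n : nat) : set R[i] :=
  [set z | n.-unity_root z].

Definition rotA (R : realType) (eta : R[i]) : 'M[R[i]]_2 :=
  \matrix_(i < 2, j < 2)
    (if i == j then 'Re eta else if i == 0 then - 'Im eta else 'Im eta).

Definition mxmap (R : realType) (M : 'M[R[i]]_2) (x : ambient R) : ambient R :=
  (M *m x.1, x.2).

(* Main.v *)
Require Import Defs.
From HB Require Import structures.
From mathcomp Require Import all_boot all_order all_algebra.
From mathcomp Require Import all_classical all_reals all_analysis.
From mathcomp Require Import complex polyXY.
From mathcomp Require Import ring.

Set Implicit Arguments.
Unset Strict Implicit.
Unset Printing Implicit Defensive.

Import Order.TTheory GRing.Theory Num.Theory numFieldNormedType.Exports.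
Local Open Scope classical_set_scope.
Local Open Scope ring_scope.

(** Put [a = u0 + i u1] and [b = u0 - i u1].  The identity defining [p0] and
    [p1], which extends from real to complex arguments, says that in the
    coordinates [(a, b)] the covering is [(a, b, s) |-> (a^k, b^k, s)]
    ([zp_sk], [zm_sk]).  For even [k] its domain is the set of [(a, b, s)] with
    [s] on the complex sphere and [a b (a^k - b^k) != 0] ([WkP]).

    An automorphism [f] over the base therefore multiplies [a] and [b] by
    [k]-th roots of unity that depend continuously on the point.  The domain
    being connected ([Wk_connected]), these roots are constant, so [f] is a
    diagonal matrix [diag(alpha, beta)] in the coordinates [(a, b)], with
    [alpha^k = beta^k = 1]; conversely all these matrices are automorphisms
    ([cov_autP]).  The group is thus [U_k x U_k], that is [Z_k x Z_k]
    ([comp_isog_cov_aut]).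

    Connectedness of the domain rests on one fact: two points of the complex
    plane off the zero set of a polynomial are joined by a path off that zero
    set ([path_avoiding_roots]).  It is applied to the complex line through two
    points of the [u]-plane, and to rational curves on the complex sphere
    ([sphere_step]).

    It remains to compare [diag(alpha, beta)] with [xi A_eta Z^delta].  For
    [|eta| = 1] the rotation [A_eta] is [diag(eta, eta^-1)], hence
    [xi A_eta = diag(xi eta, xi / eta)].  As [k] is even, these matrices only
    reach the pairs for which [alpha beta] is a square in [U_k]; the factor
    [Z = diag(lambda mu, lambda / mu)], of determinant [lambda^2], reaches the
    other coset ([root_pair_decomposition]). *)

(** * Paths avoiding finitely many points, and connected sets *)

Section Paths.
Variable R : realType.
Local Notation C := R[i].

Lemma continuous_real_complex : continuous (fun t : R => t%:C%C : C^o).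
Proof.
move=> t A /= /nbhs_ballP[e /= e0 sA]; apply/nbhs_ballP.
have /complex_realP[d ed] : e \is Num.real by exact: gtr0_real.
exists d; first by move: e0; rewrite ed ltcR.
move=> s ts; apply: sA; rewrite /ball /= in ts *.
by rewrite -rmorphB normc_def /= expr0n addr0 sqrtr_sqr ed ltcR.
Qed.

(** The parabolas [t + i c t (1 - t)], for real [c], join 0 to 1, and off the
    endpoints no two of them meet.  So each root excludes at most one value of
    [c], and one of the infinitely many natural numbers is left. *)
Lemma path_avoiding_roots (P : {poly C}) : P.[0] != 0 -> P.[1] != 0 ->
  exists g : R -> C^o, [/\ continuous g, g 0 = 0, g 1 = 1
    & forall t, 0 <= t <= 1 -> P.[g t] != 0].
Proof.
move=> P0 P1.
have [rs Prs] := closed_field_poly_normal P.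
have Pn0 : P != 0 by apply: contraNneq P0 => ->; rewrite horner0.
have rootP z : P.[z] == 0 -> z \in rs.
  rewrite Prs hornerZ mulf_eq0 lead_coef_eq0 (negbTE Pn0) /=.
  by rewrite -root_prod_XsubC.
(* [h z] is the only parameter [c] for which the parabola can meet [z]. *)
pose h (z : C) : R := complex.Im z / (complex.Re z * (1 - complex.Re z)).
have [n hn] : exists n : nat, forall z, z \in rs -> h z != n%:R.
  apply: contrapT => /forallNP hall.
  suff : \prod_(c <- [seq h z | z <- rs]) ('X - c%:P) = 0 :> {poly R}.
    by apply/eqP; rewrite monic_neq0 // monic_prod_XsubC.
  apply: (@poly_inf_roots_eq0 _ _ (fun n : nat => n%:R)).
    by move=> m n /eqP; rewrite eqr_nat => /eqP.
  move=> n; rewrite root_prod_XsubC; apply: contrapT => nn.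
  apply: (hall n) => z zrs; apply: contra_notN nn => /eqP <-.
  exact: map_f.
pose g (t : R) : C := t%:C%C + 'i%C * (n%:R * (t * (1 - t)))%:C%C.
have Reg t : complex.Re (g t) = t by rewrite /g /=; ring.
have Img t : complex.Im (g t) = n%:R * (t * (1 - t)) by rewrite /g /=; ring.
have g0 : g 0 = 0 by apply/eqP; rewrite eq_complex Reg Img mul0r mulr0 !eqxx.
have g1 : g 1 = 1 by apply/eqP; rewrite eq_complex Reg Img subrr !mulr0 !eqxx.
exists g; split=> //.
  move=> t; apply: (@cvgD _ C^o).
    exact: continuous_real_complex.
  apply: (@cvgMl_tmp C).
  apply: (@continuous_comp _ _ _ (fun t : R => n%:R * (t * (1 - t)))
    (fun t : R => t%:C%C : C^o)); last exact: continuous_real_complex.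
  apply: cvgMl_tmp; apply: cvgM; first exact: cvg_id.
  by apply: cvgB; [exact: cvg_cst|exact: cvg_id].
move=> t /andP[t0 t1].
have [->|tn0] := eqVneq t 0; first by rewrite g0.
have [->|tn1] := eqVneq t 1; first by rewrite g1.
apply/negP => /rootP/hn /eqP; apply.
by rewrite /h Reg Img mulfK // mulf_neq0 // subr_eq0 eq_sym.
Qed.

(** In this form the existence of paths proves connectedness of complements
    of hypersurfaces: [h] is a curve whose bad parameters are roots of [P]. *)
Lemma connected_component_off_roots (T : topologicalType) (A : set T)
    (P : {poly C}) (h : C^o -> T) :
  P.[0] != 0 -> P.[1] != 0 ->
  (forall z, P.[z] != 0 -> A (h z)) ->
  (forall z, P.[z] != 0 -> {for z, continuous h}) ->
  connected_component A (h 0) (h 1).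
Proof.
move=> P0 P1 Ah ch; have [g [cg g0 g1 Pg]] := path_avoiding_roots P0 P1.
exists ((h \o g) @` `[0, 1]); last first.
  by exists 1; rewrite /= ?g1 // in_itv /= lexx ler01.
split.
- by exists 0; rewrite /= ?g0 // in_itv /= lexx ler01.
- by move=> _ [t t01 <-]; apply: Ah; apply: Pg; move: t01; rewrite /= in_itv.
- apply: connected_continuous_connected; first exact: segment_connected.
  apply: continuous_in_subspaceT => t; rewrite inE /= in_itv /= => t01.
  by apply: continuous_comp; [exact: cg|exact/ch/Pg].
Qed.

(** The values lie in a finite, hence discrete, subset of the plane, so each
    fibre of [f] is both open and closed. *)
Lemma root_of_unity_constant (T : topologicalType) (k : nat) (f : T -> C^o) :
  (0 < k)%N -> connected [set: T] -> continuous f ->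
  (forall x, (f x : C) ^+ k = 1) -> forall x y, f x = f y.
Proof.
move=> k0 cT cf fk x y.
(* [rs] lists all [k]-th roots of unity. *)
have [rs rsE] : exists rs : seq C, forall z : C, z ^+ k = 1 -> z \in rs.
  have [rs Prs] := closed_field_poly_normal ('X^k - 1 : {poly C}).
  exists rs => z zk; rewrite -root_prod_XsubC.
  move: Prs; rewrite -[1]/(1%:P) lead_coefXnsubC // scale1r => <-.
  by rewrite /root !hornerE zk subrr.
have /accessible_finite_set_closed fin_closed : accessible_space C^o.
  by apply: hausdorff_accessible; exact: norm_hausdorff.
have /(congr1 (fun A => A y)) : f @^-1` [set f x] = [set: T].
  apply: cT; first by exists x.
  - exists (f @^-1` (~` [set z : C^o | z \in rs /\ z != f x])).
      apply: open_comp => [z _|]; first exact: cf.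
      apply: closed_openC; apply: fin_closed.
      by apply: sub_finite_set (finite_seq rs) => z [].
    rewrite setTI; apply/seteqP; split=> z /=; first by move=> -> [_ /eqP].
    move=> /not_andP[/(_ (rsE _ (fk z)))//|/negP].
    by rewrite negbK => /eqP.
  - exists (f @^-1` [set f x]); last by rewrite setTI.
    apply: closed_comp => [z _|]; first exact: cf.
    by apply: fin_closed; exact: finite_set1.
by move=> e; suff : (f @^-1` [set f x]) y by []; rewrite e.
Qed.

(** Passes from connectedness of a subset to connectedness of the subtype on
    which the covering is defined. *)
Lemma connected_set_type (T : topologicalType) (A : set T) :
  connected A -> connected [set: A].
Proof.
move=> cA B [b Bb] [_ [U oU <-] BU] [E cE BE].
have [F cF FE] : exists2 F, closed F & E = set_val @^-1` F.
  have [V oV VE] : open (~` E) by exact: closed_openC.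
  exists (~` V); first exact: open_closedC.
  by rewrite -[LHS]setCK -VE.
rewrite setTI in BU; rewrite setTI FE in BE.
have imB (G : set T) : B = set_val @^-1` G -> set_val @` B = A `&` G.
  move=> ->; apply/seteqP; split=> [_ [x Gx <-]|x [Ax Gx]].
    by split=> //; exact: set_valP.
  by exists (SigSub (mem_set Ax)).
have BA : set_val @` B = A.
  apply: cA; first by exists (set_val b), b.
  - by exists U => //; exact: imB.
  - by exists F => //; exact: imB.
apply/seteqP; split=> // x _.
have : (set_val @` B) (set_val x) by rewrite BA; exact: set_valP.
by case=> y By /val_inj <-.
Qed.

Lemma connected_from_component (T : topologicalType) (A : set T) :
  (forall x y, A x -> A y -> connected_component A x y) -> connected A.
Proof.
move=> AA; have [->|/set0P[x Ax]] := eqVneq A set0; first exact: connected0.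
rewrite (_ : A = connected_component A x); first exact: component_connected.
apply/seteqP; split=> [y Ay|]; first exact: AA.
exact: connected_component_sub.
Qed.

Lemma continuous_matrix (T U : topologicalType) (m n : nat)
    (f : T -> 'M[U]_(m, n)) (x : T) :
  (forall i j, {for x, continuous (fun t => f t i j)}) ->
  {for x, continuous f}.
Proof.
move=> cf B [P Pf PB].
have : \forall t \near x, forall ij : 'I_m * 'I_n, P ij.1 ij.2 (f t ij.1 ij.2).
  apply: filter_forall => -[i j]; exact: (cf i j _ (Pf i j)).
by apply: filterS => t Pt; apply: PB => i j; exact: (Pt (i, j)).
Qed.

Lemma continuous_pair (T U V : topologicalType) (f : T -> U) (g : T -> V)
    (x : T) :
  {for x, continuous f} -> {for x, continuous g} ->
  {for x, continuous (fun t => (f t, g t))}.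
Proof. by move=> cf cg; apply: cvg_pair. Qed.

End Paths.

(** * The coordinates in which the covering is a pair of power maps *)

Section IsotropicCoordinates.
Variable R : realType.
Local Notation C := R[i].
Implicit Types (x y : ambient R) (a b c d : C).

(** The two linear factors of the quadratic form [u0^2 + u1^2]. *)
Definition zp x : C := u0 x + 'i * u1 x.
Definition zm x : C := u0 x - 'i * u1 x.

Lemma u0E x : u0 x = (zp x + zm x) / 2.
Proof. by rewrite /zp /zm; field. Qed.

Lemma u1E x : u1 x = (zp x - zm x) / (2 * 'i).
Proof. by rewrite /zp /zm; field; exact: neq0Ci. Qed.

Lemma zp_zm x : zp x * zm x = u0 x ^+ 2 + u1 x ^+ 2.
Proof.
transitivity (u0 x ^+ 2 - 'i ^+ 2 * u1 x ^+ 2); first by rewrite /zp /zm; ring.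
by rewrite sqrCi mulN1r opprK.
Qed.

Lemma ambient_eq x y : zp x = zp y -> zm x = zm y -> x.2 = y.2 -> x = y.
Proof.
move=> ep em; case: x y ep em => [u s] [v t] /= ep em ->; congr (_, _).
have e0 := u0E (u, s); have e1 := u1E (u, s).
move: e0 e1; rewrite ep em -(u0E (v, t)) -(u1E (v, t)) /u0 /u1 /= => e0 e1.
apply/matrixP => i j; rewrite ord1.
by case: i => [[|[|]]] //= hi;
  [rewrite (_ : Ordinal hi = 0)|rewrite (_ : Ordinal hi = 1)];
  by [|apply: val_inj].
Qed.

(** The endomorphism of the plane [(u0, u1)] that is [diag(a, b)] in the
    coordinates [(zp, zm)]. *)
Definition zdiag a b : 'M[C]_2 :=
  \matrix_(i, j) (if i == j then (a + b) / 2
    else if i == 0 then 'i * (a - b) / 2 else (a - b) / (2 * 'i)).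

Lemma u0_mxmap (M : 'M[C]_2) x :
  u0 (mxmap M x) = M 0 0 * u0 x + M 0 1 * u1 x.
Proof.
rewrite /u0 /u1 mxE !big_ord_recl big_ord0 addr0 /=.
by rewrite (_ : lift _ _ = 1) //; apply: val_inj.
Qed.

Lemma u1_mxmap (M : 'M[C]_2) x :
  u1 (mxmap M x) = M 1 0 * u0 x + M 1 1 * u1 x.
Proof.
rewrite /u0 /u1 mxE !big_ord_recl big_ord0 addr0 /=.
by rewrite (_ : lift _ _ = 1) //; apply: val_inj.
Qed.

Lemma Ci_inv2 : (2 * 'i)^-1 = - 'i / 2 :> C.
Proof. by rewrite invfM invCi mulrC. Qed.

Lemma zp_zdiag a b x : zp (mxmap (zdiag a b) x) = a * zp x.
Proof.
rewrite /zp u0_mxmap u1_mxmap !mxE /= Ci_inv2.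
set u := u0 x; set v := u1 x.
transitivity (((a + b) / 2 - 'i ^+ 2 * (a - b) / 2) * u + 'i * a * v).
  by field.
by rewrite sqrCi; field.
Qed.

Lemma zm_zdiag a b x : zm (mxmap (zdiag a b) x) = b * zm x.
Proof.
rewrite /zm u0_mxmap u1_mxmap !mxE /= Ci_inv2.
set u := u0 x; set v := u1 x.
transitivity (((a + b) / 2 + 'i ^+ 2 * (a - b) / 2) * u - 'i * b * v).
  by field.
by rewrite sqrCi; field.
Qed.

Lemma mxmapM (M N : 'M[C]_2) x : mxmap (M *m N) x = mxmap M (mxmap N x).
Proof. by rewrite /mxmap mulmxA. Qed.

(** Lets matrix identities be checked on the coordinates [zp] and [zm]. *)
Lemma mxmap_inj (M N : 'M[C]_2) : (forall x, mxmap M x = mxmap N x) -> M = N.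
Proof.
move=> eMN; apply/matrixP => i j.
by have /(congr1 (fun y : ambient R => y.1 i 0)) := eMN (delta_mx j 0, 0);
   rewrite /= -!colE !mxE.
Qed.

Lemma zdiagM a b c d : zdiag a b *m zdiag c d = zdiag (a * c) (b * d).
Proof.
by apply: mxmap_inj => x; rewrite mxmapM; apply: ambient_eq;
  rewrite ?zp_zdiag ?zm_zdiag ?mulrA.
Qed.

Lemma rotAE (eta : C) : rotA eta = zdiag eta eta^*.
Proof.
apply/matrixP => i j; rewrite !mxE; case: ifP => // _.
rewrite ReE ?ImE //.
by case: ifP => _; rewrite ImE ?Ci_inv2; field.
Qed.

Lemma scale_zdiag c a b : c *: zdiag a b = zdiag (c * a) (c * b).
Proof.
apply/matrixP => i j; rewrite !mxE; case: ifP => _; first by field.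
by case: ifP => _; rewrite ?Ci_inv2; field.
Qed.

End IsotropicCoordinates.

Section Covering.
Variables (R : realType) (k : nat) (p0 p1 : {poly {poly R[i]}}).
Hypothesis hp : pk_pair k p0 p1.
Implicit Types (x y : ambient R).

(** The uniqueness of the pair [(p0, p1)] identifies it with a pair for which
    the identity is known on all complex arguments. *)
Lemma pk_pairC (a b : R[i]) :
  (a + 'i * b) ^+ k = p0.[a, b ^+ 2] + 'i * b * p1.[a, b ^+ 2].
Proof.
have [q0 [q1 hq]] := pk_ex R[i] k.
have [-> ->] := pk_pairU hp (fun s t => hq s%:C%C t%:C%C).
exact: hq.
Qed.

Lemma u0_sk x : u0 (sk p0 p1 x) = p0.[u0 x, u1 x ^+ 2].
Proof. by rewrite {1}/u0 mxE. Qed.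

Lemma u1_sk x : u1 (sk p0 p1 x) = u1 x * p1.[u0 x, u1 x ^+ 2].
Proof. by rewrite {1}/u1 mxE. Qed.

Lemma zp_sk x : zp (sk p0 p1 x) = zp x ^+ k.
Proof. by rewrite {1}/zp u0_sk u1_sk mulrA -pk_pairC. Qed.

Lemma zm_sk x : zm (sk p0 p1 x) = zm x ^+ k.
Proof.
have -> : zm x = u0 x + 'i * - u1 x by rewrite mulrN.
by rewrite /zm u0_sk u1_sk pk_pairC sqrrN mulrN mulNr mulrA.
Qed.

Lemma sk_eqP x y : sk p0 p1 x = sk p0 p1 y <->
  [/\ zp x ^+ k = zp y ^+ k, zm x ^+ k = zm y ^+ k & x.2 = y.2].
Proof.
rewrite -!zp_sk -!zm_sk; split=> [e|[ep em es]]; last exact: ambient_eq.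
by rewrite e; split=> //; exact: (congr1 snd e).
Qed.

Hypothesis k_even : ~~ odd k.

(** Up to a nonzero constant, [u1 * p1] is [zp^k - zm^k].  Its nonvanishing
    excludes [zp = zm], that is [u1 = 0], and for even [k] also [zp = - zm],
    that is [u0 = 0]. *)
Lemma WkP x : Wk p1 x <->
  sphere x.2 /\ zp x * zm x * (zp x ^+ k - zm x ^+ k) != 0.
Proof.
have e1 : zp x ^+ k - zm x ^+ k = 2 * 'i * (u1 x * p1.[u0 x, u1 x ^+ 2]).
  by rewrite -zp_sk -zm_sk -u1_sk {1}/zp {1}/zm; ring.
rewrite /Wk /W /= -zp_zm.
split=> [[[sx u0n u1n zn] pn]|[sx]].
  split=> //; rewrite mulf_neq0 // e1 !mulf_neq0 ?neq0Ci //.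
rewrite !mulf_eq0 !negb_or => /andP[/andP[zpn zmn] ne].
have even_pow (a : R[i]) : (- a) ^+ k = a ^+ k.
  by rewrite exprNn -signr_odd (negbTE k_even) mul1r.
split; first split=> //.
- apply: contra ne => /eqP; rewrite u0E => /eqP.
  rewrite mulf_eq0 invr_eq0 pnatr_eq0 orbF addr_eq0 => /eqP ->.
  by rewrite even_pow subrr.
- apply: contra ne => /eqP h; by rewrite e1 h mul0r mulr0.
- by rewrite zpn.
- by apply: contra ne => /eqP h; rewrite e1 h !mulr0.
Qed.

End Covering.

(** * Connectedness of the domain of the covering *)

Section Connectedness.
Variable R : realType.
Local Notation C := R[i].

Lemma connected_component_image (T U : topologicalType) (f : T -> U)
    (A : set T) (B : set U) x y :
  continuous f -> (forall z, A z -> B (f z)) ->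
  connected_component A x y -> connected_component B (f x) (f y).
Proof.
move=> cf AB [D [Dx DA Dc] Dy]; exists (f @` D); last by exists y.
split; first by exists x.
- by move=> _ [z /DA/AB Bz <-].
- apply: connected_continuous_connected => //.
  exact: continuous_subspaceT.
Qed.

Lemma horner_continuous (P : {poly C}) : continuous (fun z : C^o => P.[z] : C^o).
Proof.
elim/poly_ind: P => [|P c IH] z.
  rewrite (_ : (fun _ => _) = cst (0 : C^o)); first exact: cst_continuous.
  by apply/funext => w; rewrite horner0.
rewrite (_ : (fun _ => _) = (fun w : C^o => P.[w] * w + c : C^o)).
  apply: (@cvgD _ C^o _ _ (nbhs_filter (z : C^o))); last exact: cst_continuous.
  by apply: (@cvgM C _ _ (nbhs_filter (z : C^o))); [exact: IH|exact: cvg_id].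
by apply/funext => w; rewrite !hornerE.
Qed.

(** The negative of the reflection of [s] in the hyperplane orthogonal to [w]
    is [- s + 2 (s.w / w.w) w], again a point of the sphere.  For
    [w = s + z t] it is [s] at [z = 0] and [t] at [z = 1], and it is a rational
    function of [z] whose denominator is [w.w = 1 + 2 c z + z^2], with
    [c = s.t].  The denominator at [z = 1] is [2 (1 + c)], whence the condition
    on [c]. *)
Lemma sphere_step (s t : 'cV[C^o]_3) : sphere s -> sphere t ->
  \sum_(j < 3) (s j 0 * t j 0 : C) != -1 -> connected_component (@sphere R) s t.
Proof.
move=> ss st; set c := \sum_(j < 3) _ => cN1.
pose N : {poly C} := 2 *: (1 + c *: 'X).
pose D : {poly C} := 1 + (2 * c) *: 'X + 'X^2.
have NE z : N.[z] = 2 * (1 + c * z) by rewrite /N !hornerE.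
have DE z : D.[z] = 1 + 2 * c * z + z ^+ 2 by rewrite /D !hornerE.
have c1 : 1 + c != 0 by rewrite addrC addr_eq0.
have D1 : D.[1] != 0.
  by rewrite DE (_ : _ + _ = 2 * (1 + c)) ?mulf_neq0 ?pnatr_eq0 //; ring.
pose h (z : C^o) : 'cV[C^o]_3 := - s + (N.[z] / D.[z]) *: (s + z *: t).
have h0 : h 0 = s.
  rewrite /h NE DE scale0r addr0 !mulr0 expr0n !addr0 mulr1 divr1.
  by rewrite scaler_nat mulr2n addKr.
have h1 : h 1 = t.
  rewrite /h (_ : N.[1] = D.[1]); last by rewrite NE DE; ring.
  by rewrite divff // !scale1r addKr.
suff : connected_component (@sphere R) (h 0) (h 1) by rewrite h0 h1.
apply: (@connected_component_off_roots _ _ _ D) => //.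
- by rewrite DE !mulr0 expr0n !addr0 oner_eq0.
- move=> z Dz; rewrite /sphere /=.
  pose a := N.[z] / D.[z].
  transitivity (\sum_(j < 3) ((a - 1) ^+ 2 * (s j 0 : C) ^+ 2
      + 2 * (a - 1) * a * z * (s j 0 * t j 0)
      + a ^+ 2 * z ^+ 2 * (t j 0 : C) ^+ 2)).
    by apply: eq_bigr => j _; rewrite !mxE -/a /GRing.scale /=; ring.
  rewrite !big_split /= -!mulr_sumr ss st -/c /a NE DE in Dz *.
  by field.
- move=> z Dz; apply: continuous_matrix => i j.
  rewrite (_ : (fun _ => _) = (fun w : C^o =>
      (- s i j : C^o) + N.[w] / D.[w] * (s i j + w * t i j) : C^o)); last first.
    by apply/funext => w; rewrite !mxE.
  apply: (@cvgD _ C^o _ _ (nbhs_filter (z : C^o))); first exact: cst_continuous.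
  apply: (@cvgM C _ _ (nbhs_filter (z : C^o))).
    apply: (@cvgM C _ _ (nbhs_filter (z : C^o))); first exact: horner_continuous.
    apply: (@cvgV C _ _ (nbhs_filter (z : C^o))) => //; exact: horner_continuous.
  apply: (@cvgD _ C^o _ _ (nbhs_filter (z : C^o))); first exact: cst_continuous.
  by apply: (@cvgM C _ _ (nbhs_filter (z : C^o))); [exact: cvg_id|exact: cst_continuous].
Qed.

(** A basis vector [e_j] serves as intermediate point, for an index [j] with
    [s_j^2 != 1]; there is one because the three squares have sum 1. *)
Lemma sphere_opp (s : 'cV[C^o]_3) : sphere s ->
  connected_component (@sphere R) s (- s).
Proof.
move=> ss.
have [j sj] : exists j, (s j 0 : C) ^+ 2 != 1.
  apply: contrapT => /forallNP s1; move: ss; rewrite /sphere /=.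
  under eq_bigr => j _ do have /negP/negPn/eqP -> := s1 j.
  rewrite sumr_const card_ord => /eqP.
  by rewrite -subr_eq0 mulrSr addrK pnatr_eq0.
pose e : 'cV[C^o]_3 := delta_mx j 0.
have sphere_e : sphere e.
  rewrite /sphere /= (bigD1 j) //= big1 => [|i /negbTE ij].
    by rewrite mxE !eqxx expr1n addr0.
  by rewrite mxE ij expr0n.
have sphere_opp_s : sphere (- s).
  by rewrite /sphere /= -[RHS]ss; apply: eq_bigr => i _; rewrite mxE sqrrN.
have dot (t : 'cV[C^o]_3) :
    \sum_(i < 3) (t i 0 * e i 0 : C) = t j 0.
  rewrite (bigD1 j) //= big1 => [|i /negbTE ij].
    by rewrite mxE !eqxx mulr1 addr0.
  by rewrite mxE ij mulr0.
apply: (@connected_component_trans _ _ e).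
  apply: sphere_step => //; rewrite dot; apply: contra sj => /eqP ->.
  by rewrite sqrrN expr1n.
apply: connected_component_sym; apply: sphere_step => //.
by rewrite dot mxE eqr_opp; apply: contra sj => /eqP ->; rewrite expr1n.
Qed.

(** When [s.t = -1] the points [s] and [- t] have scalar product 1, so one goes
    from [s] to [- t] and then to [t]. *)
Lemma sphere_connected (s t : 'cV[C^o]_3) : sphere s -> sphere t ->
  connected_component (@sphere R) s t.
Proof.
move=> ss st; set c := \sum_(j < 3) (s j 0 * t j 0 : C).
have [cN1|] := eqVneq c (-1); last exact: sphere_step.
apply: (@connected_component_trans _ _ (- t)).
  apply: sphere_step => //.
    by rewrite /sphere /= -[RHS]st; apply: eq_bigr => i _; rewrite mxE sqrrN.
  under eq_bigr => j _ do rewrite mxE mulrN.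
  by rewrite sumrN -/c cN1 opprK -subr_eq0 opprK -(natrD _ 1 1) pnatr_eq0.
by apply: connected_component_sym; exact: sphere_opp.
Qed.

(** First [s] moves along the sphere with [u] fixed, then [u] moves along the
    complex line to its target; the bad parameters on this line are the roots
    of the product of the restricted equations in [WkP]. *)
Lemma Wk_connected (k : nat) (p0 p1 : {poly {poly C}}) :
  pk_pair k p0 p1 -> ~~ odd k -> connected (Wk p1).
Proof.
move=> hp k_even; apply: connected_from_component => x y.
move=> /(WkP hp k_even)[sx nx] /(WkP hp k_even)[sy ny].
apply: (@connected_component_trans _ _ (x.1, y.2)).
  rewrite {1}(surjective_pairing x).
  apply: (@connected_component_image _ _ (fun s => (x.1, s)) (@sphere R)).
  - move=> s; apply: (@continuous_pair _ _ _ (fun=> x.1) id).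
      exact: cst_continuous.
    exact: cvg_id.
  - by move=> s ss; apply/(WkP hp k_even).
  - exact: sphere_connected.
pose h (z : C^o) : ambient R := (x.1 + z *: (y.1 - x.1), y.2).
have -> : (x.1, y.2) = h 0 by rewrite /h scale0r addr0.
have -> : y = h 1 by rewrite /h scale1r addrC subrK -surjective_pairing.
pose pp : {poly C} := (zp x)%:P + (zp y - zp x) *: 'X.
pose pm : {poly C} := (zm x)%:P + (zm y - zm x) *: 'X.
have ppE z : pp.[z] = zp (h z).
  by rewrite /pp !hornerE /zp /u0 /u1 !mxE /GRing.scale /=; ring.
have pmE z : pm.[z] = zm (h z).
  by rewrite /pm !hornerE /zm /u0 /u1 !mxE /GRing.scale /=; ring.
have PE z : (pp * pm * (pp ^+ k - pm ^+ k)).[z] =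
    zp (h z) * zm (h z) * (zp (h z) ^+ k - zm (h z) ^+ k).
  by rewrite hornerM hornerD hornerN hornerM !horner_exp ppE pmE.
apply: (@connected_component_off_roots _ _ _ (pp * pm * (pp ^+ k - pm ^+ k))).
- by rewrite PE /h scale0r addr0.
- by rewrite PE /h scale1r addrC subrK.
- by move=> z; rewrite PE => hz; apply/(WkP hp k_even).
- move=> z _; apply: (@continuous_pair C^o 'cV[C^o]_2 'cV[C^o]_3
    (fun w => x.1 + w *: (y.1 - x.1)) (fun=> y.2)); last exact: cst_continuous.
  apply: continuous_matrix => i j.
  rewrite (_ : (fun _ => _) = (fun w : C^o =>
      (x.1 i j : C^o) + w * (y.1 - x.1) i j : C^o)); last first.
    by apply/funext => w; rewrite !mxE.
  apply: (@cvgD _ C^o _ _ (nbhs_filter (z : C^o))).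
    exact: cst_continuous.
  by apply: (@cvgM C _ _ (nbhs_filter (z : C^o)));
    [exact: cvg_id|exact: cst_continuous].
Qed.

End Connectedness.

(** * The automorphisms of the covering *)

Section Automorphisms.
Variables (R : realType) (k : nat) (p0 p1 : {poly {poly R[i]}}).
Hypotheses (k_gt0 : (0 < k)%N) (k_even : ~~ odd k) (hp : pk_pair k p0 p1).
Local Notation C := R[i].
Local Notation incl := (set_val : Wk p1 -> ambient R).
Implicit Types (a b c d : C).

Lemma continuous_u0 : continuous (fun x : ambient R => u0 x : C^o).
Proof.
move=> x; apply: (@continuous_comp _ _ _ fst
  (fun v : 'cV[C^o]_2 => v 0 0 : C^o)); first exact: cvg_fst.
exact: coord_continuous.
Qed.

Lemma continuous_u1 : continuous (fun x : ambient R => u1 x : C^o).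
Proof.
move=> x; apply: (@continuous_comp _ _ _ fst
  (fun v : 'cV[C^o]_2 => v 1 0 : C^o)); first exact: cvg_fst.
exact: coord_continuous.
Qed.

Lemma continuous_u_comb (c d : C) :
  continuous (fun x : ambient R => c * u0 x + d * u1 x : C^o).
Proof.
move=> x; apply: (@cvgD _ C^o _ _ (nbhs_filter x)).
  apply: (@cvgM C _ _ (nbhs_filter x)); first exact: cst_continuous.
  exact: continuous_u0.
apply: (@cvgM C _ _ (nbhs_filter x)); first exact: cst_continuous.
exact: continuous_u1.
Qed.

Lemma continuous_zp : continuous (fun x : ambient R => zp x : C^o).
Proof.
rewrite (_ : (fun _ => _) = (fun x => 1 * u0 x + 'i * u1 x : C^o)).
  exact: continuous_u_comb.
by apply/funext => x; rewrite mul1r.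
Qed.

Lemma continuous_zm : continuous (fun x : ambient R => zm x : C^o).
Proof.
rewrite (_ : (fun _ => _) = (fun x => 1 * u0 x + (- 'i) * u1 x : C^o)).
  exact: continuous_u_comb.
by apply/funext => x; rewrite mul1r mulNr.
Qed.

Lemma continuous_mxmap (M : 'M[C]_2) : continuous (mxmap M).
Proof.
move=> x; apply: (@continuous_pair (ambient R) 'cV[C^o]_2 'cV[C^o]_3
  (fun x => M *m x.1) snd); last exact: cvg_snd.
apply: continuous_matrix => i j.
rewrite (_ : (fun _ => _) = (fun x => M i 0 * u0 x + M i 1 * u1 x : C^o)).
  exact: continuous_u_comb.
apply/funext => y; rewrite ord1 mxE !big_ord_recl big_ord0 addr0.
by rewrite (_ : lift _ _ = 1) //; exact: val_inj.
Qed.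

(** The default value of [insubd] never occurs when [a] and [b] are [k]-th
    roots of unity, by [incl_deck]. *)
Definition deck a b (x : Wk p1) : Wk p1 := insubd x (mxmap (zdiag a b) (incl x)).

Lemma root_of_unity_neq0 a : a ^+ k = 1 -> a != 0.
Proof. by apply: contra_eq_neq => ->; rewrite expr0n gtn_eqF // eq_sym oner_neq0. Qed.

Lemma incl_deck a b : a ^+ k = 1 -> b ^+ k = 1 ->
  incl \o deck a b = mxmap (zdiag a b) \o incl.
Proof.
move=> ak bk; apply/funext => x; apply: insubdK; rewrite inE.
have /(WkP hp k_even)[sx nx] := set_valP x.
apply/(WkP hp k_even); split=> //; rewrite zp_zdiag zm_zdiag !exprMn ak bk !mul1r.
rewrite mulrACA -(mulrA (a * b)); apply: mulf_neq0 _ nx.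
by apply: mulf_neq0; exact: root_of_unity_neq0.
Qed.

Lemma sk_deck a b : a ^+ k = 1 -> b ^+ k = 1 ->
  (sk p0 p1 \o incl) \o deck a b = sk p0 p1 \o incl.
Proof.
move=> ak bk; rewrite -compA incl_deck //; apply/funext => x.
by apply/(sk_eqP hp); rewrite zp_zdiag zm_zdiag !exprMn ak bk !mul1r.
Qed.

Lemma incl_inj (f g : Wk p1 -> Wk p1) : incl \o f = incl \o g -> f = g.
Proof. by move=> e; apply/funext => x; apply: val_inj; exact: (congr1 (@^~ x) e). Qed.

Lemma deckM a b c d : a ^+ k = 1 -> b ^+ k = 1 -> c ^+ k = 1 -> d ^+ k = 1 ->
  deck (a * c) (b * d) = deck a b \o deck c d.
Proof.
move=> ak bk ck dk; apply: incl_inj.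
rewrite incl_deck ?exprMn ?ak ?bk ?ck ?dk ?mulr1 //.
rewrite compA incl_deck // -compA incl_deck // -zdiagM.
by apply/funext => x /=; rewrite mxmapM.
Qed.

Lemma deck11 : deck 1 1 = id.
Proof.
apply: incl_inj; rewrite incl_deck ?expr1n //; apply/funext => x.
by apply: ambient_eq; rewrite /= ?zp_zdiag ?zm_zdiag ?mul1r.
Qed.

Lemma continuous_deck a b : a ^+ k = 1 -> b ^+ k = 1 -> continuous (deck a b).
Proof.
move=> ak bk; apply: continuous_comp_initial; rewrite incl_deck //.
move=> x; apply: continuous_comp; first exact: initial_continuous.
exact: continuous_mxmap.
Qed.

Lemma cov_aut_deck a b : a ^+ k = 1 -> b ^+ k = 1 ->
  cov_aut (sk p0 p1 \o incl) (deck a b).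
Proof.
move=> ak bk; split; last exact: sk_deck.
have ak' : a^-1 ^+ k = 1 by rewrite exprVn ak invr1.
have bk' : b^-1 ^+ k = 1 by rewrite exprVn bk invr1.
split; first exact: continuous_deck.
exists (deck a^-1 b^-1); split; first exact: continuous_deck.
- move=> x; rewrite -[LHS]/((deck _ _ \o deck _ _) x) -deckM //.
  by rewrite !mulVf ?root_of_unity_neq0 // deck11.
- move=> x; rewrite -[LHS]/((deck _ _ \o deck _ _) x) -deckM //.
  by rewrite !mulfV ?root_of_unity_neq0 // deck11.
Qed.

(** The quotient [q (f x) / q x] is a continuous function with values among the
    [k]-th roots of unity, on a connected space. *)
Lemma quotient_constant (q : ambient R -> C) (f : Wk p1 -> Wk p1) :
  continuous (q : ambient R -> C^o) -> continuous f ->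
  (forall x, q (incl x) != 0) ->
  (forall x, q (incl (f x)) ^+ k = q (incl x) ^+ k) ->
  exists2 a, a ^+ k = 1 & forall x, q (incl (f x)) = a * q (incl x).
Proof.
move=> cq cf q0 qf.
have [x0|/forallNP noX] := pselect (exists x : Wk p1, True); last first.
  by exists 1; [rewrite expr1n|move=> x; case: (noX x)].
have {x0} [x0 _] := x0.
pose g x : C^o := q (incl (f x)) / q (incl x).
have gk x : (g x : C) ^+ k = 1.
  by rewrite /g expr_div_n qf divff // expf_neq0.
exists (g x0) => // x.
rewrite (_ : g x0 = g x) ?/g ?divfK //.
apply: (root_of_unity_constant k_gt0 _ _ gk).
  by apply: connected_set_type; exact: Wk_connected hp k_even.
move=> z; apply: (@cvgM C _ _ (nbhs_filter z)).
  apply: (@continuous_comp _ _ _ f (q \o incl : _ -> C^o)); first exact: cf.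
  by apply: continuous_comp; [exact: initial_continuous|exact: cq].
apply: (@cvgV C _ _ (nbhs_filter z)) => //.
by apply: continuous_comp; [exact: initial_continuous|exact: cq].
Qed.

Lemma cov_autP f : cov_aut (sk p0 p1 \o incl) f <->
  exists a b, [/\ a ^+ k = 1, b ^+ k = 1 & f = deck a b].
Proof.
split=> [[[cf _] skf]|[a [b [ak bk ->]]]]; last exact: cov_aut_deck.
have fE x : [/\ zp (incl (f x)) ^+ k = zp (incl x) ^+ k,
    zm (incl (f x)) ^+ k = zm (incl x) ^+ k & (incl (f x)).2 = (incl x).2].
  by apply/(sk_eqP hp); exact: (congr1 (@^~ x) skf).
have z0 x : zp (incl x) * zm (incl x) != 0.
  have /(WkP hp k_even)[_] := set_valP x.
  by rewrite mulf_eq0 negb_or => /andP[].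
have [a ak fa] : exists2 a, a ^+ k = 1 &
    forall x, zp (incl (f x)) = a * zp (incl x).
  apply: quotient_constant => // [|x|x]; first exact: continuous_zp.
    by have := z0 x; rewrite mulf_eq0 negb_or => /andP[].
  by case: (fE x).
have [b bk fb] : exists2 b, b ^+ k = 1 &
    forall x, zm (incl (f x)) = b * zm (incl x).
  apply: quotient_constant => // [|x|x]; first exact: continuous_zm.
    by have := z0 x; rewrite mulf_eq0 negb_or => /andP[].
  by case: (fE x).
exists a, b; split=> //; apply: incl_inj; rewrite incl_deck //.
apply/funext => x; apply: ambient_eq; rewrite /= ?zp_zdiag ?zm_zdiag //.
by case: (fE x).
Qed.

(** Needed for a deck transformation to determine its two roots of unity.  The
    witness has [zp = 1] and [zm = 2]. *)
Lemma Wk_nonempty : exists x : Wk p1, zp (incl x) * zm (incl x) != 0.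
Proof.
pose x : ambient R := (\col_(i < 2) (if i == 0 then 3 / 2 else - 1 / (2 * 'i)),
  delta_mx 0 0).
have zpx : zp x = 1.
  by rewrite /zp /u0 /u1 !mxE /=; field; exact: neq0Ci.
have zmx : zm x = 2.
  by rewrite /zm /u0 /u1 !mxE /=; field; exact: neq0Ci.
have Wx : Wk p1 x.
  apply/(WkP hp k_even); split.
    by rewrite /sphere /= !big_ord_recl big_ord0 !mxE /= expr1n expr0n !addr0.
  rewrite zpx zmx expr1n mul1r mulf_neq0 ?pnatr_eq0 // subr_eq0 eq_sym.
  by rewrite -natrX pnatr_eq1 -(expn0 2) eqn_exp2l // gtn_eqF.
exists (SigSub (mem_set Wx)).
by rewrite /= zpx zmx mul1r pnatr_eq0.
Qed.

Lemma deck_inj a b c d : a ^+ k = 1 -> b ^+ k = 1 -> c ^+ k = 1 -> d ^+ k = 1 ->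
  deck a b = deck c d -> a = c /\ b = d.
Proof.
move=> ak bk ck dk e; have [x] := Wk_nonempty.
rewrite mulf_eq0 negb_or => /andP[px mx].
have {}e : mxmap (zdiag a b) (incl x) = mxmap (zdiag c d) (incl x).
  rewrite -[LHS]/((mxmap _ \o incl) x) -[RHS]/((mxmap _ \o incl) x).
  by rewrite -!incl_deck // e.
split; [apply: (mulIf px)|apply: (mulIf mx)].
  by rewrite -(zp_zdiag a b) -(zp_zdiag c d) e.
by rewrite -(zm_zdiag a b) -(zm_zdiag c d) e.
Qed.

Lemma comp_isog_cov_aut (w : C) : (1 < k)%N -> k.-primitive_root w ->
  comp_isog (cov_aut (sk p0 p1 \o incl)) ('Z_k * 'Z_k)%type.
Proof.
move=> k_gt1 hw.
have wk (m : nat) : (w ^+ m) ^+ k = 1 by rewrite exprAC (prim_expr_order hw) expr1n.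
have wD (m n : 'Z_k) : w ^+ (m + n)%R = w ^+ m * w ^+ n.
  rewrite -exprD -(prim_expr_mod hw (m + n)%N).
  by congr (w ^+ (_ %% _)); exact: Zp_cast.
have ltZ (m : 'Z_k) : (m < k)%N by rewrite -[X in (_ < X)%N](Zp_cast k_gt1).
have w_inj (m n : 'Z_k) : w ^+ m = w ^+ n -> m = n.
  move=> /eqP; rewrite (eq_prim_root_expr hw) !modn_small // => /eqP.
  exact: val_inj.
have w_surj a : a ^+ k = 1 -> exists m : 'Z_k, a = w ^+ m.
  move=> /(prim_rootP hw)[i ->]; exists (i%:R).
  by rewrite val_Zp_nat // modn_small.
exists (fun m : 'Z_k * 'Z_k => deck (w ^+ m.1) (w ^+ m.2)); split.
- move=> [m n] [m' n'] /(deck_inj (wk _) (wk _) (wk _) (wk _))[/=].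
  by move=> /w_inj -> /w_inj ->.
- apply/seteqP; split=> [_ [m _ <-]|f /cov_autP[a [b [ak bk ->]]]].
    exact: cov_aut_deck.
  have [m ->] := w_surj _ ak; have [n ->] := w_surj _ bk.
  by exists (m, n).
- by move=> m n; rewrite !wD deckM.
Qed.

End Automorphisms.

(** * Pairs of roots of unity *)

Section RootsOfUnity.
Variables (C : numClosedFieldType) (k : nat).
Hypothesis k_gt0 : (0 < k)%N.

Lemma conj_root_of_unity (n : nat) (z : C) : (0 < n)%N -> z ^+ n = 1 -> z^* = z^-1.
Proof.
move=> n0 zn; rewrite invC_norm.
have /eqP : `|z| ^+ n = 1 by rewrite -normrX zn normr1.
by rewrite pexpr_eq1 ?normr_ge0 // => /eqP ->; rewrite expr1n invr1 mul1r.
Qed.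

Lemma prim_root_half (z : C) : (2 * k)%N.-primitive_root z -> z ^+ k = -1.
Proof.
move=> hz; have : (z ^+ k) ^+ 2 == 1.
  by rewrite -exprM mulnC (prim_expr_order hz).
rewrite sqrf_eq1 => /orP[|/eqP //].
rewrite -(prim_order_dvd hz) => /(dvdn_leq k_gt0).
by rewrite leqNgt mul2n -addnn -[X in (X < _)%N]addn0 ltn_add2l k_gt0.
Qed.

(** Write [a = lambda^(2p)] and [b = lambda^(2q)].  Then [lambda^(p + q)] and
    [lambda^(p - q)] have product [a] and quotient [b], and their [k]-th powers
    are [(-1)^(p + q)].  If [p + q] is odd, dividing them by [lambda] and [mu],
    whose [k]-th powers are also -1, turns them into [k]-th roots of unity. *)
Lemma root_pair_decomposition (lambda mu a b : C) :
  (2 * k)%N.-primitive_root lambda -> (2 * k)%N.-primitive_root mu ->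
  a ^+ k = 1 -> b ^+ k = 1 ->
  exists xi eta (d : 'I_2), [/\ xi ^+ k = 1, eta ^+ k = 1,
    a = xi * eta * (lambda * mu) ^+ d & b = xi / eta * (lambda / mu) ^+ d].
Proof.
move=> hl hm ak bk.
have lk := prim_root_half hl; have mk := prim_root_half hm.
have l0 : lambda != 0.
  by rewrite (prim_root_eq0 hl) -lt0n muln_gt0 k_gt0.
have m0 : mu != 0 by rewrite (prim_root_eq0 hm) -lt0n muln_gt0 k_gt0.
have hw : k.-primitive_root (lambda ^+ 2).
  have := dvdn_prim_root hl (dvdn_mull 2 (dvdnn k)).
  by rewrite mulnK.
have [p aE] := prim_rootP hw ak; have [q bE] := prim_rootP hw bk.
have lX n : (lambda ^+ n) ^+ k = (-1) ^+ n by rewrite exprAC lk.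
have [pq|pq] := boolP (odd (p + q)).
- exists (lambda ^+ (p + q) / lambda), (lambda ^+ p / lambda ^+ q / mu), 1.
  split.
  + by rewrite expr_div_n lX lk -signr_odd pq divff // oppr_eq0 oner_eq0.
  + rewrite !expr_div_n !lX mk invr_sign -exprD -signr_odd pq.
    by rewrite divff // oppr_eq0 oner_eq0.
  + rewrite aE expr1 -exprM mulnC exprM exprD; field.
    by rewrite l0 m0 expf_neq0.
  + rewrite bE expr1 -exprM mulnC exprM exprD; field.
    by rewrite l0 m0 !expf_neq0.
- exists (lambda ^+ (p + q)), (lambda ^+ p / lambda ^+ q), 0.
  split.
  + by rewrite lX -signr_odd (negbTE pq).
  + by rewrite expr_div_n !lX invr_sign -exprD -signr_odd (negbTE pq).
  + by rewrite aE expr0 mulr1 -exprM mulnC exprM exprD; field; rewrite expf_neq0.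
  + by rewrite bE expr0 mulr1 -exprM mulnC exprM exprD; field; rewrite !expf_neq0.
Qed.

End RootsOfUnity.

(** * The automorphism group *)

(* A self-map of [Wk p1] is compared with a matrix after composing with the
   inclusion [set_val] of [Wk p1] in the ambient space. *)
Theorem proposition6p3 (R : realType) (k : nat) (k_gt0 : (0 < k)%N)
    (k_even : ~~ odd k) (p0 p1 : {poly {poly R[i]}}) (hp : pk_pair k p0 p1)
    (lambda mu : R[i]) (hlambda : (2 * k)%N.-primitive_root lambda)
    (hmu : (2 * k)%N.-primitive_root mu) :
  let Z := lambda *: rotA mu in
  let incl := (set_val : Wk p1 -> ambient R) in
  let AutS := cov_aut (sk p0 p1 \o incl) in
  [set incl \o f | f in AutS] =
    [set h | exists (xi eta : R[i]) (delta : 'I_2), [/\ U k xi, U k eta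
       & h = mxmap (xi *: rotA eta *m Z ^+ delta) \o incl]]
  /\ comp_isog AutS ('Z_k * 'Z_k)%type.
Proof.
move=> Z incl AutS.
have k_gt1 : (1 < k)%N by case: (k) k_gt0 k_even => [|[]].
have hw : k.-primitive_root (lambda ^+ 2).
  by have := dvdn_prim_root hlambda (dvdn_mull 2 (dvdnn k)); rewrite mulnK.
split; last exact: comp_isog_cov_aut hp _ k_gt1 hw.
have rotE (n : nat) (z : R[i]) : (0 < n)%N -> z ^+ n = 1 -> rotA z = zdiag z z^-1.
  by move=> n0 zn; rewrite rotAE (conj_root_of_unity n0 zn).
have lk := prim_root_half k_gt0 hlambda; have mk := prim_root_half k_gt0 hmu.
have ZE : Z = zdiag (lambda * mu) (lambda / mu).
  by rewrite /Z (rotE _ _ _ (prim_expr_order hmu)) ?muln_gt0 // scale_zdiag.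
have matE (xi eta : R[i]) (d : 'I_2) : eta ^+ k = 1 ->
    xi *: rotA eta *m Z ^+ d =
    zdiag (xi * eta * (lambda * mu) ^+ d) (xi / eta * (lambda / mu) ^+ d).
  move=> ek; rewrite (rotE _ _ k_gt0 ek) scale_zdiag.
  by case: d => [[|[|]]] //= _; rewrite ?expr0 ?expr1 ?mulmx1 ?mulr1 // ZE zdiagM.
apply/seteqP; split=> [_ [f /(cov_autP k_gt0 k_even hp)[a [b [ak bk ->]]] <-]|h].
  have [xi [eta [d [xk ek aE bE]]]] :=
    root_pair_decomposition k_gt0 hlambda hmu ak bk.
  exists xi, eta, d; split; [exact/unity_rootP|exact/unity_rootP|].
  by rewrite matE // -aE -bE; apply: (incl_deck k_gt0 k_even hp ak bk).
move=> [xi [eta [d [/unity_rootP xk /unity_rootP ek ->]]]].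
have ak : (xi * eta * (lambda * mu) ^+ d) ^+ k = 1.
  by rewrite 2!exprMn xk ek exprAC exprMn lk mk mulrNN !mul1r expr1n.
have bk : (xi / eta * (lambda / mu) ^+ d) ^+ k = 1.
  rewrite exprMn expr_div_n xk ek exprAC expr_div_n lk mk.
  by rewrite !divff ?oppr_eq0 ?oner_eq0 // expr1n mulr1.
exists (deck (xi * eta * (lambda * mu) ^+ d) (xi / eta * (lambda / mu) ^+ d)).
  exact: (cov_aut_deck k_gt0 k_even hp ak bk).
by rewrite matE //; apply: (incl_deck k_gt0 k_even hp ak bk).
Qed.
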